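(* Let $p\ge 1$ be an integer, let $c, v\in\mathbb{R}^p$ with $c^{T}v> 0$, let $\lambda\in\mathbb{R}$ with $\lambda\le 0$, and let $j\ge 0$ be an integer. Define $h(t)=c^{T}v\,e^{\lambda t}t^{j}$ and $$\underline{h}(t)=c^{T}v\,\lambda\,t^{j+1}+c^{T}v\,t^{j}.$$ Then $\underline{h}(t)\le h(t)$ for all $t\ge 0$.
   Context: Here $v$ stands for either the state $x[t_k]\in\mathbb{R}^n$ or the control input $u[t_k]\in\mathbb{R}^m$ of a linear system $\dot x=Ax+Bu$ with zeroth-order-hold control, at the start of an update interval. The function $h$ is one term of the expansion of an affine predicate along the trajectory, where $\lambda$ is a real eigenvalue of $A$ and $j$ is the polynomial power coming from a Jordan block. Convention: $t^{0}=1$. *)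

(* Defs.v *)
From mathcomp Require Import all_boot all_order all_algebra.
From mathcomp Require Import reals sequences exp.

Set Implicit Arguments.
Unset Strict Implicit.
Unset Printing Implicit Defensive.

Import Order.TTheory GRing.Theory Num.Theory.

Local Open Scope ring_scope.

(* c^T v is a 1 x 1 matrix; its single entry is the scalar product. *)
Definition dotv (R : realType) (p : nat) (c v : 'cV[R]_p) : R :=
  (c^T *m v) 0 0.

(* x ^+ 0 = 1 for every x, including 0, so the convention t^0 = 1 is built in. *)
Definition h (R : realType) (p : nat) (c v : 'cV[R]_p) (lambda : R) (j : nat)
    (t : R) : R :=
  dotv c v * expR (lambda * t) * t ^+ j.

Definition h_lower (R : realType) (p : nat) (c v : 'cV[R]_p) (lambda : R)
    (j : nat) (t : R) : R :=
  dotv c v * lambda * t ^+ j.+1 + dotv c v * t ^+ j.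

(* Main.v *)
Require Import Defs.
From mathcomp Require Import all_boot all_order all_algebra.
From mathcomp Require Import reals sequences exp.

Import Order.TTheory GRing.Theory Num.Theory.

Local Open Scope ring_scope.

Theorem mainTheorem4 (R : realType) (p : nat) (hp : (1 <= p)%N)
    (c v : 'cV[R]_p) (hcv : 0 < dotv c v)
    (lambda : R) (hlambda : lambda <= 0) (j : nat) :
  forall t : R, 0 <= t -> h_lower c v lambda j t <= h c v lambda j t.
Proof.
(* The tangent line of exp at 0: 1 + lambda * t <= exp (lambda * t). *)
move=> t t_ge0; rewrite /h /h_lower exprS mulrA -mulrDl -mulrA -[X in _ + X]mulr1 -mulrDr.
(* Factored, the lower bound is [dotv c v * (lambda * t + 1) * t ^+ j]: it is [h] with the
   exponential replaced by its tangent line. The common factor [t ^+ j] preserves the order because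
   [t] is nonnegative. *)
apply: ler_wpM2r; first exact: exprn_ge0.
(* The sign of [dotv c v] likewise preserves the order, leaving the tangent inequality at
   [lambda * t]. *)
by apply: ler_wpM2l; [exact: ltW | rewrite addrC expR_ge1Dx].
Qed.
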